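(* Let $\mathcal{C}^n=(M^n,K(x,p))$, $n\ge 4$, be an $m$-th root Cartan space, $m\ge 3$, with metric $K(x,p)=\sqrt[m]{a^{i_1i_2\ldots i_m}(x)p_{i_1}p_{i_2}\cdots p_{i_m}}$, and suppose that the matrix $(a^{ij})$ is invertible. Then $\mathcal{C}^n$ is an $S3$-like Cartan space if and only if the d-tensor $U^{hijk}=a_r^{ij}a^{rhk}-a_r^{ik}a^{rhj}$ is of the form $$U^{hijk}=\lambda\left\{h^{hj}h^{ik}-h^{hk}h^{ij}\right\},$$ where $\lambda=\lambda(x,p)$ is a positively $0$-homogeneous scalar function (homogeneity being with respect to $p$).
   Context: The summation convention is used; indices (including the index $h$) run over $1,\dots,n$; $(x^i,p_i)$ are the induced local coordinates on the cotangent bundle $T^*M$ of an $n$-dimensional smooth manifold $M$; $\dot\partial^i=\partial/\partial p_i$. All identities are on $T^*M\setminus\{0\}$. A Cartan space $(M^n,K(x,p))$ is a manifold $M$ with a real function $K$ on $T^*M$ which is positive and differentiable (smooth) on $T^*M\setminus\{0\}$, continuous on the null section, positively $1$-homogeneous in the momenta $p_i$, and such that the matrix $g^{ij}(x,p)=\frac12\dot\partial^i\dot\partial^jK^2$ is positive definite on $T^*M\setminus\{0\}$. It is an $m$-th root Cartan space if $K(x,p)=\sqrt[m]{a^{i_1\ldots i_m}(x)p_{i_1}\cdots p_{i_m}}$, where $a^{i_1\ldots i_m}(x)$ depends on the position only and is symmetric in all its indices. Notation: $a^{ij}=\left[a^{iji_3\ldots i_m}(x)p_{i_3}\cdots p_{i_m}\right]/K^{m-2}$,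 $a^{ijk}=\left[a^{ijki_4\ldots i_m}(x)p_{i_4}\cdots p_{i_m}\right]/K^{m-3}$. The matrix $(a_{ij})$ is the inverse of $(a^{ij})$, and $a_i^{jk}=a_{is}a^{sjk}$. The matrix $(g_{ij})$ is the inverse of $(g^{ij})$. The angular metrical d-tensor is $h^{ij}=K\dot\partial^i\dot\partial^jK$. The $v$-torsion d-tensor is $C^{ijk}=-\frac12\dot\partial^kg^{ij}$, $C_i^{jk}=g_{is}C^{sjk}$, and the $v$-curvature d-tensor is $S^{hijk}=C_r^{ij}C^{rhk}-C_r^{ik}C^{rhj}$. A Cartan space with $n\ge 4$ is called $S3$-like if there exists a scalar function $S=S(x,p)$, positively $0$-homogeneous in $p$, such that $K^2S^{hijk}=S\left\{h^{hj}h^{ik}-h^{hk}h^{ij}\right\}$. *)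

(* Defs.v *)
From HB Require Import structures.
From mathcomp Require Import all_boot all_order all_algebra.
From mathcomp Require Import all_classical all_reals all_analysis.
Set Implicit Arguments.
Unset Strict Implicit.
Unset Printing Implicit Defensive.
Import Order.TTheory GRing.Theory Num.Theory.
Import numFieldNormedType.Exports.
Local Open Scope classical_set_scope.
Local Open Scope ring_scope.

Section Smooth.
Variables (R : realType) (V W : normedModType R).

Definition iter_derive (s : seq V) (f : V -> W) : V -> W :=
  foldr (fun v g => 'D_v g) f s.

(* For V of finite dimension and D open this is C^oo: the iterated partial
   derivatives of all orders exist and, being differentiable, are continuous. *)
Definition smooth_on (D : set V) (f : V -> W) : Prop :=
  forall (s : seq V) (x : V), D x -> differentiable (iter_derive s f) x.

End Smooth.

Definition partial (R : realType) (n : nat) (i : 'I_n) (f : 'rV[R]_n -> R) :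
    'rV[R]_n -> R :=
  'D_(delta_mx 0 i) f.

(* [coord c] and [param c] are total functions; they are meaningful only on
   [dom c] and on the open set [coord c @` dom c], where they are mutually
   inverse. [chart_at] selects one chart around each point. *)
Record smooth_manifold (R : realType) (n : nat) := SmoothManifold {
  carrier :> topologicalType;
  chart : Type;
  dom : chart -> set carrier;
  coord : chart -> carrier -> 'rV[R]_n;
  param : chart -> 'rV[R]_n -> carrier;
  chart_at : carrier -> chart;
  carrier_hausdorff : hausdorff_space carrier;
  carrier_second_countable : @second_countable carrier;
  dom_open : forall c, open (dom c);
  coord_open : forall c, open (coord c @` dom c);
  coordK : forall c x, dom c x -> param c (coord c x) = x;
  coord_cont : forall c x, dom c x -> {for x, continuous (coord c)};
  param_cont : forall c x, dom c x -> {for coord c x, continuous (param c)};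
  chart_atP : forall x, dom (chart_at x) x;
  transition_smooth : forall c d,
    smooth_on (coord c @` (dom c `&` dom d)) (coord d \o param c)
}.

Section Cotangent.
Variables (R : realType) (n : nat) (M : smooth_manifold R n).

(* (x, p) is the covector at x whose components in the chart [chart_at x]
   are the p_i. *)
Definition cotangent : Type := (M * 'rV[R]_n)%type.

Definition nonzero (z : cotangent) : Prop := z.2 != 0.

(* The covector p_i dx^i at x, where the x^i are the coordinates of the chart
   c around x. With y^j the coordinates of [chart_at x], its components there
   are p_i (partial x^i / partial y^j). *)
Definition covector (c : chart M) (x : M) (p : 'rV[R]_n) : cotangent :=
  let d := chart_at x in
  (x, \row_j \sum_(i < n)
        p 0 i * partial j (fun y => coord c (param d y) 0 i) (coord d x)).

(* The expression of f in the coordinates (x^i, p_i) induced by c. *)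
Definition in_chart (f : cotangent -> R) (c : chart M)
    (z : 'rV[R]_n * 'rV[R]_n) : R :=
  f (covector c (param c z.1) z.2).

(* Scaling the components in one chart scales them in every chart. *)
Definition pos_homogeneous (r : nat) (f : cotangent -> R) : Prop :=
  forall (x : M) (p : 'rV[R]_n) (t : R),
    p != 0 -> 0 < t -> f (x, t *: p) = t ^+ r * f (x, p).

End Cotangent.

(* Vertical tensors on one cotangent space: F is the function K(x, .) of the
   momenta p_i, for a fixed x and a fixed chart around x. *)
Section Vertical.
Variables (R : realType) (n : nat) (F : 'rV[R]_n -> R).
Implicit Types (p : 'rV[R]_n) (h i j k : 'I_n).

Definition g_up i j p : R :=
  2^-1 * partial i (partial j (fun q => F q ^+ 2)) p.

Definition g_up_mx p : 'M[R]_n := \matrix_(i, j) g_up i j p.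

Definition g_down i j p : R := invmx (g_up_mx p) i j.

Definition h_up i j p : R := F p * partial i (partial j F) p.

Definition C_up i j k p : R := - 2^-1 * partial k (g_up i j) p.

(* [C_mixed i j k] is C_i^{jk}. *)
Definition C_mixed i j k p : R := \sum_(s < n) g_down i s p * C_up s j k p.

Definition S_up h i j k p : R :=
  \sum_(r < n) (C_mixed r i j p * C_up r h k p - C_mixed r i k p * C_up r h j p).

Definition hh h i j k p : R :=
  h_up h j p * h_up i k p - h_up h k p * h_up i j p.

End Vertical.

Definition positive_definite (R : realType) (n : nat) (A : 'M[R]_n) : Prop :=
  forall v : 'rV[R]_n, v != 0 -> 0 < \sum_(i < n) \sum_(j < n) A i j * v 0 i * v 0 j.

Section MthRoot.
Variables (R : realType) (n m : nat).

(* Only the values of b on sequences of length m matter: b [:: i_1; ...; i_m]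
   is a^{i_1 ... i_m} at a fixed point. *)
Variables (b : seq 'I_n -> R) (F : 'rV[R]_n -> R).
Implicit Types (p : 'rV[R]_n) (s t : seq 'I_n) (h i j k : 'I_n).

Definition symmetric_coefs : Prop :=
  forall s t, size s = m -> perm_eq s t -> b s = b t.

(* All the indices but those in s are contracted with p. *)
Definition contract s p : R :=
  \sum_(t : (m - size s).-tuple 'I_n) b (s ++ t) * \prod_(k <- t) p 0 k.

Definition a_up2 i j p : R := contract [:: i; j] p / F p ^+ (m - 2).

Definition a_up3 i j k p : R := contract [:: i; j; k] p / F p ^+ (m - 3).

Definition a_up2_mx p : 'M[R]_n := \matrix_(i, j) a_up2 i j p.

Definition a_down i j p : R := invmx (a_up2_mx p) i j.

(* [a_mixed i j k] is a_i^{jk}. *)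
Definition a_mixed i j k p : R := \sum_(s < n) a_down i s p * a_up3 s j k p.

Definition U_up h i j k p : R :=
  \sum_(r < n) (a_mixed r i j p * a_up3 r h k p - a_mixed r i k p * a_up3 r h j p).

End MthRoot.

Section CartanSpace.
Variables (R : realType) (n : nat) (M : smooth_manifold R n).
Variable K : cotangent M -> R.

Definition fibre (f : cotangent M -> R) (c : chart M) (x : M) : 'rV[R]_n -> R :=
  fun p => f (covector c x p).

Record is_cartan : Prop := IsCartan {
  cartan_pos : forall z, nonzero z -> 0 < K z;
  cartan_smooth : forall c : chart M,
    smooth_on [set z | (coord c @` dom c) z.1 /\ z.2 != 0] (in_chart K c);
  cartan_cont0 : forall (c : chart M) (x : M), dom c x ->
    {for (coord c x, 0), continuous (in_chart K c)};
  cartan_homog : pos_homogeneous 1 K;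
  cartan_posdef : forall (c : chart M) (x : M) (p : 'rV[R]_n),
    dom c x -> p != 0 -> positive_definite (g_up_mx (fibre K c x) p)
}.

(* a c x are the components a^{i_1 ... i_m}(x) in the chart c. The radicand is
   required to be nonnegative because [powR] takes junk values otherwise. *)
Definition is_mth_root (m : nat) (a : chart M -> M -> seq 'I_n -> R) : Prop :=
  forall (c : chart M) (x : M), dom c x ->
    symmetric_coefs m (a c x) /\
    forall p : 'rV[R]_n,
      0 <= contract m (a c x) [::] p /\
      fibre K c x p = contract m (a c x) [::] p `^ (m%:R^-1).

Definition S3_like : Prop :=
  exists2 S : cotangent M -> R, pos_homogeneous 0 S &
    forall (c : chart M) (x : M) (p : 'rV[R]_n) (h i j k : 'I_n),
      dom c x -> p != 0 ->
      fibre K c x p ^+ 2 * S_up (fibre K c x) h i j k p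
      = fibre S c x p * hh (fibre K c x) h i j k p.

End CartanSpace.

(* Main.v *)
(* Fix a point x and a chart, let F = K(x, .), e_s = a^s for a multi-index s
   (the radicand contracted with p in the indices outside s, divided by
   F^(m - |s|)) and l_k = p_k / F.  Then l_k e_(s k) = e_s and
     d e_s / d p_k = (m - |s|) / F (e_(s k) - e_s e_k),
   whence, with a^i = e_i,
     h^ij = (m - 1) (a^ij - a^i a^j),
     g^ij = (m - 1) a^ij - (m - 2) a^i a^j,
     g_ij = (a_ij + (m - 2) l_i l_j) / (m - 1),
     C^ijk = - (m - 1) (m - 2) / (2 F) T^ijk,
   where T^ijk = a^ijk - a^ij a^k - a^ik a^j - a^jk a^i + 2 a^i a^j a^k is
   annihilated by l.  Substituting in the definition of S^hijk,
     F^2 S^hijk = (m - 1) (m - 2)^2 / 4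
       (U^hijk + (h^hj h^ik - h^hk h^ij) / (m - 1)^2),
   so the scalars S and lambda determine each other by an affine relation with
   constant coefficients and nonzero slope. *)
Require Import Defs.
From mathcomp Require Import all_boot all_order all_algebra.
From mathcomp Require Import all_classical all_reals all_analysis.
From mathcomp Require Import ring zify.
Import Order.TTheory GRing.Theory Num.Theory.
Import numFieldNormedType.Exports.
Local Open Scope classical_set_scope.
Local Open Scope ring_scope.

Set Implicit Arguments.
Unset Strict Implicit.
Unset Printing Implicit Defensive.

(** * Chain rule for real powers *)

Lemma is_derive_powR_comp (R : realType) (V : normedModType R) (f : V -> R)
    (x v : V) (a df : R) :
  differentiable f x -> 0 < f x -> is_derive x v f df ->
  is_derive x v (fun y => f y `^ a) (a * f x `^ (a - 1) * df).
Proof.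
move=> dfx f_gt0 [_ <-].
have [gD <-] := is_derive1_powR a f_gt0.
have dg : differentiable (fun y : R => y `^ a) (f x).
  exact/derivable1_diffP.
have dc : differentiable ((fun y : R => y `^ a) \o f) x.
  exact: differentiable_comp.
apply: DeriveDef; first exact: diff_derivable.
rewrite (deriveE v dc) diff_comp //= (deriveE v dfx) (deriveE _ dg).
by rewrite -[in LHS](mulr1 ('d f x v)) -[_ * 1]/(_ *: _) linearZ mulrC.
Qed.

(** * Contractions of symmetric coefficients with the momenta *)

Section Contraction.
(* [contract] alone would denote the operation on extended reals. *)
Local Notation contract := Defs.contract.
Variables (R : realType) (n m : nat) (b : seq 'I_n -> R).
Implicit Types (p : 'rV[R]_n) (s t : seq 'I_n) (i j k : 'I_n).

Lemma sum_tupleS (r : nat) (f : seq 'I_n -> R) :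
  \sum_(t : r.+1.-tuple 'I_n) f t = \sum_(k < n) \sum_(t : r.-tuple 'I_n) f (k :: t).
Proof.
rewrite pair_bigA /=.
rewrite (reindex (fun u : 'I_n * r.-tuple 'I_n => [tuple of u.1 :: u.2])) //=.
exists (fun t : r.+1.-tuple 'I_n => (thead t, [tuple of behead t])) => [[k t] _|t _] /=.
  by rewrite theadE; congr pair; apply: val_inj.
by rewrite -tuple_eta.
Qed.

(** The first contracted index is split off; this recursion drives the inductions below on the
    number of contracted indices. *)
Lemma contract_rec s p : (size s < m)%N ->
  contract m b s p = \sum_(k < n) p 0 k * contract m b (rcons s k) p.
Proof.
move=> lt_sm; rewrite /contract -subnSK //.
rewrite (sum_tupleS _ (fun t => b (s ++ t) * \prod_(k <- t) p 0 k)).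
apply: eq_bigr => k _; rewrite size_rcons mulr_sumr; apply: eq_bigr => t _.
by rewrite big_cons cat_rcons mulrCA.
Qed.

Lemma contract_full s p : size s = m -> contract m b s p = b s.
Proof.
move=> sm; rewrite /contract sm subnn (big_pred1 [tuple]) => [|t].
  by rewrite cats0 big_nil mulr1.
by apply/esym/eqP/val_inj; case: t => -[].
Qed.

Hypothesis b_sym : symmetric_coefs m b.

Lemma contract_perm s t p : (size s <= m)%N -> perm_eq s t ->
  contract m b s p = contract m b t p.
Proof.
move=> le_sm st; rewrite /contract -(perm_size st); apply: eq_bigr => u _.
congr (_ * _); apply: b_sym; last by rewrite perm_cat2r.
by rewrite size_cat size_tuple subnKC.
Qed.

Lemma contract_diff s p : (size s <= m)%N ->
  differentiable (contract m b s) p.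
Proof.
move: {2}(m - size s)%N (erefl (m - size s)%N) => r; elim: r s => [|r IHr] s.
  move/eqP; rewrite subn_eq0 => le_ms le_sm.
  rewrite (_ : contract m b s = cst (b s)); first exact: differentiable_cst.
  by apply/funext => q; apply/contract_full/eqP; rewrite eqn_leq le_sm.
move=> ms _; have lt_sm : (size s < m)%N by rewrite -subn_gt0 ms.
rewrite (_ : contract m b s =
  \sum_(k < n) ((fun q : 'rV[R]_n => q 0 k) * contract m b (rcons s k))); last first.
  by apply/funext => q; rewrite contract_rec // fct_sumE.
apply: differentiable_sum => k; apply: differentiableM.
  exact: differentiable_coord.
by apply: IHr; rewrite size_rcons // subnS ms.
Qed.

Lemma is_derive_coord p (v : 'rV[R]_n) k :
  is_derive p v (fun q : 'rV[R]_n => q 0 k) (v 0 k).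
Proof.
have dk : differentiable (fun q : 'rV[R]_n => q 0 k) p by exact: differentiable_coord.
apply: DeriveDef; first exact: diff_derivable.
apply/lim_near_cst => //=.
near=> h; rewrite /= !mxE addrK [_ *: _]mulrA mulVf ?mul1r //.
by near: h; exact: nbhs_dnbhs_neq.
Unshelve. all: by end_near. Qed.

(** Leibniz rule on [contract_rec]: the coordinate factor yields one copy of the contraction, and
    the inner contractions yield the other [r] copies, after symmetry swaps j and k. At [size s = m]
    the coefficient is 0. *)
Lemma is_derive_contract s p k : (size s <= m)%N ->
  is_derive p (delta_mx 0 k) (contract m b s)
    ((m - size s)%:R * contract m b (rcons s k) p).
Proof.
move: {2}(m - size s)%N (erefl (m - size s)%N) => r; elim: r s => [|r IHr] s.
  move=> ms le_sm; rewrite ms mul0r.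
  rewrite (_ : contract m b s = cst (b s)); first exact: is_derive_cst.
  apply/funext => q; apply/contract_full/eqP.
  by rewrite eqn_leq le_sm -subn_eq0 ms.
move=> ms _; have lt_sm : (size s < m)%N by rewrite -subn_gt0 ms.
rewrite (_ : contract m b s =
  \sum_(j < n) ((fun q : 'rV[R]_n => q 0 j) * contract m b (rcons s j))); last first.
  by apply/funext => q; rewrite contract_rec // fct_sumE.
have dS : is_derive p (delta_mx 0 k) (\sum_(j < n)
      ((fun q : 'rV[R]_n => q 0 j) * contract m b (rcons s j)))
    (\sum_(j < n) (p 0 j * (r%:R * contract m b (rcons (rcons s j) k) p)
      + contract m b (rcons s j) p * (delta_mx 0 k : 'rV[R]_n) 0 j)).
  apply: is_derive_sum => j; apply: is_deriveM; first exact: is_derive_coord.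
  have -> : r = (m - size (rcons s j))%N by rewrite size_rcons subnS ms.
  by apply: IHr; rewrite size_rcons // subnS ms.
apply: is_derive_eq.
rewrite big_split /= [X in _ + X](bigD1 k) //= [X in _ + (_ + X)]big1 => [|j jk]; last first.
  by rewrite mxE eqxx (negPf jk) mulr0.
rewrite mxE !eqxx mulr1 addr0 ms.
(* For [r = 0] no index is left to contract after [rcons s k], so [contract_rec] only serves the
   other case. *)
have [r0|r_gt0] := posnP r.
  by rewrite r0 big1 ?add0r ?mul1r // => j _; rewrite mul0r mulr0.
rewrite -natr1 mulrDl mul1r; congr (_ + _).
rewrite (@contract_rec (rcons s k)); last by rewrite size_rcons -subn_gt0 subnS ms.
rewrite mulr_sumr; apply: eq_bigr => j _; rewrite mulrCA; congr (_ * (_ * _)).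
apply: contract_perm.
  by rewrite !size_rcons -subn_gt0 subnS ms.
by rewrite -!cats1 -!catA perm_cat2l /= (perm_catC [:: j]).
Qed.

End Contraction.

(** * Tensor algebra at one covector, with [c] in the role of m - 1 and [D] in that of a_ij *)

Section VerticalAlgebra.
Variables (R : fieldType) (n : nat) (c : R).
Variables (l a1 : 'I_n -> R) (a2 D : 'I_n -> 'I_n -> R)
  (a3 : 'I_n -> 'I_n -> 'I_n -> R).
Hypothesis c_neq0 : c != 0.
Hypothesis a2C : forall i j, a2 i j = a2 j i.
Hypothesis a3C12 : forall i j k, a3 i j k = a3 j i k.
Hypothesis a3C23 : forall i j k, a3 i j k = a3 i k j.
Hypothesis l_a1 : \sum_(k < n) l k * a1 k = 1.
Hypothesis l_a2 : forall i, \sum_(k < n) l k * a2 k i = a1 i.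
Hypothesis l_a3 : forall i j, \sum_(k < n) l k * a3 k i j = a2 i j.
Hypothesis D_a2 : forall r h, \sum_(s < n) D r s * a2 s h = (r == h)%:R.
Hypothesis a2_D : forall h s, \sum_(r < n) a2 h r * D r s = (h == s)%:R.

Definition torsion s j k : R :=
  a3 s j k - a2 s j * a1 k - a2 s k * a1 j - a2 j k * a1 s + 2 * (a1 s * a1 j * a1 k).

Definition metric i j : R := c * a2 i j - (c - 1) * (a1 i * a1 j).

Definition metric_inv i j : R := c^-1 * (D i j + (c - 1) * (l i * l j)).

(** Lowering uses [D], the inverse of [a2], and not the inverse of [metric]; [raise_torsion]
    compares the two. *)
Definition lower3 (f : 'I_n -> 'I_n -> 'I_n -> R) r i j : R :=
  \sum_(s < n) D r s * f s i j.

Lemma sum_delta (f : 'I_n -> R) i : \sum_(r < n) (i == r)%:R * f r = f i.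
Proof.
rewrite (bigD1 i) //= eqxx mul1r big1 ?addr0 // => r ri.
by rewrite eq_sym (negPf ri) mul0r.
Qed.

(** The vector [X] is left arbitrary, to be taken as [l], as a row of [D] and as [lower3 a3]. *)
Lemma dot_torsion (X : 'I_n -> R) j k :
  \sum_(s < n) X s * torsion s j k = \sum_(s < n) X s * a3 s j k
    - (\sum_(s < n) X s * a2 s j) * a1 k - (\sum_(s < n) X s * a2 s k) * a1 j
    - (\sum_(s < n) X s * a1 s) * a2 j k
    + (\sum_(s < n) X s * a1 s) * (2 * (a1 j * a1 k)).
Proof.
rewrite !mulr_suml -!sumrB -big_split /=.
by apply: eq_bigr => s _; rewrite /torsion; ring.
Qed.

Lemma l_torsion j k : \sum_(s < n) l s * torsion s j k = 0.
Proof. by rewrite dot_torsion l_a1 !l_a2 l_a3; ring. Qed.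

(** By [l_a2] and symmetry, a1 is a2 applied to l, and [D] inverts a2. *)
Lemma D_a1 r : \sum_(s < n) D r s * a1 s = l r.
Proof.
under eq_bigr => s _ do rewrite -l_a2 mulr_sumr.
rewrite exchange_big /= -[RHS](sum_delta l); apply: eq_bigr => k _.
rewrite -D_a2 mulr_suml; apply: eq_bigr => s _.
by rewrite (a2C k); ring.
Qed.

Lemma lower3_a2 i j h : \sum_(r < n) lower3 a3 r i j * a2 r h = a3 i j h.
Proof.
under eq_bigr => r _ do rewrite mulr_suml.
rewrite exchange_big /= a3C23 a3C12 -[RHS](sum_delta (fun s => a3 s i j)); apply: eq_bigr => s _.
rewrite -a2_D mulr_suml; apply: eq_bigr => r _.
by rewrite (a2C r); ring.
Qed.

Lemma lower3_a1 i j : \sum_(r < n) lower3 a3 r i j * a1 r = a2 i j.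
Proof.
under eq_bigr => r _ do rewrite -l_a2 mulr_sumr.
rewrite exchange_big /= -l_a3; apply: eq_bigr => k _.
rewrite a3C12 a3C23 -lower3_a2 mulr_sumr; apply: eq_bigr => r _.
by rewrite (a2C k); ring.
Qed.

Lemma lower3_torsion r i j : lower3 torsion r i j =
  lower3 a3 r i j - (i == r)%:R * a1 j - (j == r)%:R * a1 i
  - l r * (a2 i j - 2 * (a1 i * a1 j)).
Proof.
by rewrite /lower3 dot_torsion !D_a2 D_a1 (eq_sym r i) (eq_sym r j); ring.
Qed.

(** Sherman-Morrison: [metric] is a rank-one perturbation of [c] times [a2], so its inverse is a
    rank-one perturbation of [D] divided by [c]. *)
Lemma metric_invP i k :
  \sum_(j < n) metric i j * metric_inv j k = (i == k)%:R.
Proof.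
have a2_l : \sum_(j < n) a2 i j * l j = a1 i.
  by rewrite -l_a2; apply: eq_bigr => j _; rewrite a2C mulrC.
have a1_D : \sum_(j < n) a1 j * D j k = l k.
  under eq_bigr => j _ do rewrite -l_a2 mulr_suml.
  rewrite exchange_big /= -[RHS](sum_delta l); apply: eq_bigr => s _.
  rewrite eq_sym -a2_D mulr_suml; apply: eq_bigr => r _.
  by ring.
have a1_l : \sum_(j < n) a1 j * l j = 1.
  by rewrite -l_a1; apply: eq_bigr => j _; rewrite mulrC.
transitivity (\sum_(j < n) a2 i j * D j k
  + (\sum_(j < n) a2 i j * l j) * ((c - 1) * l k)
  - (\sum_(j < n) a1 j * D j k) * (c^-1 * (c - 1) * a1 i)
  - (\sum_(j < n) a1 j * l j) * (c^-1 * (c - 1) ^+ 2 * a1 i * l k)).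
  rewrite !mulr_suml -big_split -!sumrB /=.
  apply: eq_bigr => j _.
  by rewrite /metric /metric_inv; field.
by rewrite a2_D a2_l a1_D a1_l; field.
Qed.

(** The rank-one part of [metric_inv] drops out because [l] annihilates the torsion. *)
Lemma raise_torsion r i j :
  \sum_(s < n) metric_inv r s * torsion s i j = c^-1 * lower3 torsion r i j.
Proof.
transitivity (c^-1 * (\sum_(s < n) D r s * torsion s i j)
    + c^-1 * (c - 1) * l r * (\sum_(s < n) l s * torsion s i j)).
  rewrite !mulr_sumr -big_split /=; apply: eq_bigr => s _.
  by rewrite /metric_inv; ring.
by rewrite l_torsion mulr0 addr0.
Qed.

(** In the expansion of the lowered factor by [lower3_torsion], the [l] term is killed by
    [l_torsion], the Kronecker deltas evaluate the torsion, and [dot_torsion] handles the rest. *)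
Lemma torsion_square i j h k :
  \sum_(r < n) lower3 torsion r i j * torsion r h k =
  \sum_(r < n) lower3 a3 r i j * a3 r h k
  - a2 i j * a2 h k
  - (a3 i j h * a1 k + a3 i j k * a1 h + a3 i h k * a1 j + a3 j h k * a1 i)
  + 2 * (a2 i j * a1 h * a1 k) + 2 * (a2 h k * a1 i * a1 j)
  + (a2 i h * a1 k * a1 j + a2 i k * a1 h * a1 j
     + a2 j h * a1 k * a1 i + a2 j k * a1 h * a1 i)
  - 4 * (a1 i * a1 j * a1 h * a1 k).
Proof.
transitivity (\sum_(r < n) lower3 a3 r i j * torsion r h k
  - (\sum_(r < n) (i == r)%:R * torsion r h k) * a1 j
  - (\sum_(r < n) (j == r)%:R * torsion r h k) * a1 i
  - (\sum_(r < n) l r * torsion r h k) * (a2 i j - 2 * (a1 i * a1 j))).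
  rewrite !mulr_suml -!sumrB; apply: eq_bigr => r _.
  by rewrite lower3_torsion; ring.
rewrite !sum_delta l_torsion dot_torsion !lower3_a2 lower3_a1 /torsion.
by ring.
Qed.

(** The terms of [torsion_square] symmetric in j and k cancel, among them those pairing [a3] with
    [a1] and the quartic one. The surviving terms without [a3] factor through a^ij - a^i a^j. *)
Lemma torsion_curvature h i j k :
  \sum_(r < n) (lower3 torsion r i j * torsion r h k
                - lower3 torsion r i k * torsion r h j) =
  \sum_(r < n) (lower3 a3 r i j * a3 r h k - lower3 a3 r i k * a3 r h j)
  + ((a2 h j - a1 h * a1 j) * (a2 i k - a1 i * a1 k)
     - (a2 h k - a1 h * a1 k) * (a2 i j - a1 i * a1 j)).
Proof.
rewrite !sumrB !torsion_square.
rewrite (a3C23 i k h) (a3C23 i k j) (a3C23 i j h) (a3C12 k) (a3C23 h k j).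
rewrite (a3C12 j h k) (a2C i h) (a2C j h) (a2C k h) (a2C k j).
by ring.
Qed.

End VerticalAlgebra.

(** * Vertical derivatives of an m-th root metric *)

Section MthRootCalculus.
Local Notation contract := Defs.contract.
Variables (R : realType) (n m : nat) (b : seq 'I_n -> R) (F : 'rV[R]_n -> R).
Hypothesis m_ge3 : (3 <= m)%N.
Hypothesis b_sym : symmetric_coefs m b.
Hypothesis F_root : forall q, F q = contract m b [::] q `^ (m%:R^-1).
Implicit Types (p : 'rV[R]_n) (s t : seq 'I_n) (h i j k : 'I_n).

(** This is e_s; for two and three indices it is convertible to [a_up2] and [a_up3]. *)
Definition ncontract s p : R := contract m b s p / F p ^+ (m - size s).

Local Notation A := (contract m b [::]).
Local Notation M := (m%:R : R).
Local Notation e := ncontract.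

Lemma root_gt0 p : 0 < A p -> 0 < F p.
Proof. by move=> A_gt0; rewrite F_root powR_gt0. Qed.

Lemma root_expm p : 0 < A p -> F p ^+ m = A p.
Proof.
move=> A_gt0; rewrite F_root -powR_mulrn ?powR_ge0 // -powRrM mulVf ?powRr1 ?ltW //.
by rewrite pnatr_eq0 -lt0n; lia.
Qed.

Lemma ncontract_nil p : 0 < A p -> e [::] p = 1.
Proof.
by move=> A_gt0; rewrite /e subn0 root_expm // divff // gt_eqF.
Qed.

Lemma ncontract_perm s t p : (size s <= m)%N -> perm_eq s t -> e s p = e t p.
Proof.
by move=> sm st; rewrite /e (contract_perm b_sym p sm st) (perm_size st).
Qed.

Lemma ncontract_rec s p : 0 < A p -> (size s < m)%N ->
  \sum_(k < n) p 0 k / F p * e (rcons s k) p = e s p.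
Proof.
move=> A_gt0 sm; have F_neq0 := lt0r_neq0 (root_gt0 A_gt0).
rewrite /e (contract_rec b p sm) mulr_suml; apply: eq_bigr => k _.
by rewrite size_rcons -(subnSK sm) exprS; field; rewrite F_neq0 expf_neq0.
Qed.

Lemma near_radicand_gt0 p : 0 < A p -> \forall q \near p, 0 < A q.
Proof.
move=> A_gt0; have /differentiable_continuous cA : differentiable A p.
  by apply: contract_diff.
by apply: (cvgr_gt _ cA).
Qed.

Lemma is_derive_root p k : 0 < A p -> is_derive p (delta_mx 0 k) F (e [:: k] p).
Proof.
move=> A_gt0; have -> : F = fun q => A q `^ (M^-1) by apply/funext => q; exact: F_root.
have dA := @is_derive_contract _ _ _ _ b_sym [::] p k (leq0n m).
have dAp : differentiable A p by apply: contract_diff.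
apply: is_derive_eq (is_derive_powR_comp M^-1 dAp A_gt0 dA) _.
have F_neq0 := lt0r_neq0 (root_gt0 A_gt0).
have A_neq0 := lt0r_neq0 A_gt0.
have M_neq0 : M != 0 by rewrite pnatr_eq0 -lt0n; lia.
(* The power A^(1/m - 1) becomes F / F^m, which leaves the F^(m - 1) in the denominator of [e
   [:: k]]. *)
rewrite powRB ?A_neq0 ?implybT // powRr1 ?ltW // -F_root -(root_expm A_gt0).
rewrite /e /= subn0 -[in F p ^+ m](@subnK 1 m) ?addn1 ?exprS; last by lia.
by field; rewrite M_neq0 F_neq0 expf_neq0.
Qed.

(** Quotient rule: the numerator gains the index k, the power of F gives the factor e_k, and both
    come with the coefficient m - |s|. *)
Lemma is_derive_ncontract s p k : 0 < A p -> (size s < m)%N ->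
  is_derive p (delta_mx 0 k) (e s)
    ((m - size s)%:R / F p * (e (rcons s k) p - e s p * e [:: k] p)).
Proof.
move=> A_gt0 sm; have F_neq0 := lt0r_neq0 (root_gt0 A_gt0).
have [r ms] : exists r, (m - size s)%N = r.+1 by exists (m - size s).-1; lia.
have dF := is_derive_root k A_gt0.
have dFr := is_deriveX r.+1 dF.
have Fr_neq0 : (F ^+ r.+1) p != 0 by rewrite exprfctE expf_neq0.
have dV : is_derive p (delta_mx 0 k) (fun q => ((F ^+ r.+1) q)^-1)
    (- ((F ^+ r.+1) p) ^- 2 *: ((r.+1%:R * F p ^+ r) *: e [:: k] p)).
  apply: DeriveDef; first by apply: derivableV => //; case: dFr.
  by rewrite deriveV //; case: dFr => _ ->.
have dC := is_derive_contract b_sym p k (ltnW sm).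
have eE : e s = contract m b s * (fun q => ((F ^+ r.+1) q)^-1).
  by apply/funext => q; rewrite /e ms mulrfctE exprfctE.
rewrite [X in is_derive _ _ X _]eE; apply: is_derive_eq (is_deriveM dC dV) _.
have mk : (m - size (rcons s k))%N = r by rewrite size_rcons; lia.
rewrite [e s p]/e [e (rcons s k) p]/e ms mk !exprfctE !exprS expr0 /GRing.scale /=.
by field; rewrite F_neq0 !expf_neq0.
Qed.

(** The closed forms of derivatives are known where the radicand is positive; this condition is
    open, so they can be differentiated again. *)
Lemma partial_eq p k (f g : 'rV[R]_n -> R) (dg : R) : 0 < A p ->
  (forall q, 0 < A q -> f q = g q) -> is_derive p (delta_mx 0 k) g dg ->
  partial k f p = dg.
Proof.
move=> A_gt0 fg [_ <-]; apply: near_eq_derive.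
by apply: filterS (near_radicand_gt0 A_gt0) => q; exact: fg.
Qed.

Lemma partial_root p k : 0 < A p -> partial k F p = e [:: k] p.
Proof. by move=> A_gt0; case: (is_derive_root k A_gt0) => _. Qed.

Lemma h_upE p i j : 0 < A p ->
  h_up F i j p = (M - 1) * (e [:: j; i] p - e [:: j] p * e [:: i] p).
Proof.
move=> A_gt0; have F_neq0 := lt0r_neq0 (root_gt0 A_gt0).
have d1 := @is_derive_ncontract [:: j] p i A_gt0 (ltnW m_ge3).
rewrite /h_up (partial_eq A_gt0 _ d1) => [|q]; last exact: partial_root.
by rewrite natrB /=; [field | lia].
Qed.

Lemma g_upE p i j : 0 < A p ->
  g_up F i j p = (M - 1) * e [:: i; j] p - (M - 2) * (e [:: i] p * e [:: j] p).
Proof.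
move=> A_gt0; have F_neq0 := lt0r_neq0 (root_gt0 A_gt0).
have dF := is_derive_root i A_gt0.
have d1 := @is_derive_ncontract [:: j] p i A_gt0 (ltnW m_ge3).
(* The partial derivative of F^2 in p_j is 2 F e_j. *)
have d2 := is_deriveZ 2 (is_deriveM dF d1).
rewrite /g_up (partial_eq A_gt0 _ d2) => [|q Aq_gt0]; last first.
  have dFq := is_deriveX 2 (is_derive_root j Aq_gt0).
  rewrite (partial_eq Aq_gt0 _ dFq) => [|u _]; last by rewrite exprfctE.
  by rewrite /= /GRing.scale /= -mulrA.
rewrite (@ncontract_perm [:: i; j] [:: j; i] _ (ltnW m_ge3)); last first.
  by rewrite (perm_catC [:: i] [:: j]).
by rewrite /= /GRing.scale /= natrB /=; [field | lia].
Qed.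

(** In the derivative of [g_upE], e_ij has coefficient m - 1 and weight m - 2 while e_i and e_j have
    them exchanged, hence the common factor. *)
Lemma C_upE p i j k : 0 < A p ->
  C_up F i j k p = - ((M - 1) * (M - 2) / (2 * F p)) *
    torsion (fun i => e [:: i] p) (fun i j => e [:: i; j] p)
      (fun i j k => e [:: i; j; k] p) i j k.
Proof.
move=> A_gt0; have F_neq0 := lt0r_neq0 (root_gt0 A_gt0).
have di := @is_derive_ncontract [:: i] p k A_gt0 (ltnW m_ge3).
have dj := @is_derive_ncontract [:: j] p k A_gt0 (ltnW m_ge3).
have dij := @is_derive_ncontract [:: i; j] p k A_gt0 m_ge3.
have d := is_deriveB (is_deriveZ (M - 1) dij) (is_deriveZ (M - 2) (is_deriveM di dj)).
rewrite /C_up (partial_eq A_gt0 _ d) => [|q Aq_gt0]; last exact: g_upE.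
rewrite /torsion /= /GRing.scale /= !natrB /=; [by field | lia..].
Qed.

Lemma S_upE p h i j k : 0 < A p -> a_up2_mx m b F p \in unitmx ->
  F p ^+ 2 * S_up F h i j k p =
  (M - 1) * (M - 2) ^+ 2 / 4 *
    (U_up m b F h i j k p + (M - 1) ^- 2 * hh F h i j k p).
Proof.
move=> A_gt0 a2_unit; have F_neq0 := lt0r_neq0 (root_gt0 A_gt0).
have c_neq0 : M - 1 != 0 by rewrite subr_eq0 gt_eqF // ltr1n ltnW.
pose l i := p 0 i / F p; pose a1 i := e [:: i] p.
pose a2 i j := e [:: i; j] p; pose a3 i j k := e [:: i; j; k] p.
pose D i j := a_down m b F i j p.
have a2C i' j' : a2 i' j' = a2 j' i'.
  apply: ncontract_perm => //; first exact: ltnW.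
  by rewrite (perm_catC [:: i'] [:: j']).
have a3C12 i' j' k' : a3 i' j' k' = a3 j' i' k'.
  apply: ncontract_perm => //.
  by rewrite (perm_cat2r [:: k'] [:: i'; j'] [:: j'; i']) (perm_catC [:: i'] [:: j']).
have a3C23 i' j' k' : a3 i' j' k' = a3 i' k' j'.
  apply: ncontract_perm => //.
  by rewrite (perm_cat2l [:: i'] [:: j'; k'] [:: k'; j']) (perm_catC [:: j'] [:: k']).
have l_a1 : \sum_k l k * a1 k = 1.
  by rewrite -(ncontract_nil A_gt0) -(@ncontract_rec [::] _ A_gt0) // ltnW // ltnW.
have l_a2 i' : \sum_k l k * a2 k i' = a1 i'.
  rewrite /a1 -(@ncontract_rec [:: i'] _ A_gt0 (ltnW m_ge3)).
  by apply: eq_bigr => k' _; rewrite a2C.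
have l_a3 i' j' : \sum_k l k * a3 k i' j' = a2 i' j'.
  rewrite /a2 -(@ncontract_rec [:: i'; j'] _ A_gt0 m_ge3).
  by apply: eq_bigr => k' _; rewrite a3C12 a3C23.
have D_a2 r u : \sum_v D r v * a2 v u = (r == u)%:R.
  have := congr1 (fun X : 'M[R]_n => X r u) (mulVmx a2_unit); rewrite !mxE => <-.
  by apply: eq_bigr => v _; rewrite mxE.
have a2_D r u : \sum_v a2 r v * D v u = (r == u)%:R.
  have := congr1 (fun X : 'M[R]_n => X r u) (mulmxV a2_unit); rewrite !mxE => <-.
  by apply: eq_bigr => v _; rewrite mxE.
have gE r u : g_down F r u p = metric_inv (M - 1) l D r u.
  (* A right inverse of a square matrix is its inverse, which identifies [g_down] with the explicit
     formula. *)
  have G_inv : g_up_mx F p *m (\matrix_(r, u) metric_inv (M - 1) l D r u) = 1%:M.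
    apply/matrixP => r' u'; rewrite !mxE.
    rewrite -(metric_invP c_neq0 a2C l_a1 l_a2 a2_D); apply: eq_bigr => v _.
    rewrite !mxE g_upE // /metric -/(a2 _ _) -/(a1 _) -/(a1 _).
    by ring.
  have [G_unit _] := mulmx1_unit G_inv.
  by rewrite /g_down -[invmx _]mulmx1 -G_inv mulKmx // mxE.
pose T := torsion a1 a2 a3; pose q := - ((M - 1) * (M - 2) / (2 * F p)).
have CE r i' j' : C_up F r i' j' p = q * T r i' j' by exact: C_upE.
have CmE r i' j' : C_mixed F r i' j' p = q / (M - 1) * lower3 D T r i' j'.
  rewrite -mulrA -(raise_torsion _ D l_a1 l_a2 l_a3) /C_mixed mulr_sumr.
  by apply: eq_bigr => s _; rewrite CE gE mulrCA.
have SE : S_up F h i j k p = q ^+ 2 / (M - 1) *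
    \sum_r (lower3 D T r i j * T r h k - lower3 D T r i k * T r h j).
  rewrite /S_up mulr_sumr; apply: eq_bigr => r _.
  by rewrite !CmE !CE; ring.
have UE : U_up m b F h i j k p =
    \sum_r (lower3 D a3 r i j * a3 r h k - lower3 D a3 r i k * a3 r h j) by [].
(* F^2 q^2 / (m - 1) is the leading constant, and each a^ij - a^i a^j is h^ij / (m - 1). *)
rewrite SE (torsion_curvature a2C a3C12 a3C23 l_a1 l_a2 l_a3 D_a2 a2_D) -UE /hh.
rewrite !h_upE // -!/(a1 _) -!/(a2 _ _) (a2C j) (a2C k) (a2C j) (a2C k) /q.
by field; rewrite c_neq0 F_neq0.
Qed.

End MthRootCalculus.

(** * Equivalence of the two curvature conditions *)

Lemma unitmx0 (R : comUnitRingType) (n : nat) :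
  (0 < n)%N -> (0 : 'M[R]_n) \notin unitmx.
Proof. by case: n => // n _; rewrite unitmxE det0 unitr0. Qed.

Theorem theorem3p4 (R : realType) (n m : nat) (M : smooth_manifold R n)
    (K : cotangent M -> R) (a : chart M -> M -> seq 'I_n -> R)
    (n_ge4 : (4 <= n)%N) (m_ge3 : (3 <= m)%N)
    (K_cartan : is_cartan K) (K_root : is_mth_root K m a)
    (a_inv : forall (c : chart M) (x : M) (p : 'rV[R]_n),
      dom c x -> p != 0 -> a_up2_mx m (a c x) (fibre K c x) p \in unitmx) :
  S3_like K <->
  exists2 lambda : cotangent M -> R, pos_homogeneous 0 lambda &
    forall (c : chart M) (x : M) (p : 'rV[R]_n) (h i j k : 'I_n),
      dom c x -> p != 0 ->
      U_up m (a c x) (fibre K c x) h i j k p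
      = fibre lambda c x p * hh (fibre K c x) h i j k p.
Proof.
(* If the radicand vanished, the division by [K ^+ (m - 2) = 0] in [a_up2]
   would make the matrix (a^ij) zero, hence singular. *)
have radicand_gt0 c x (p : 'rV[R]_n) : dom c x -> p != 0 -> 0 < Defs.contract m (a c x) [::] p.
  move=> cx p0; have [_ /(_ p)[A_ge0 FE]] := K_root c x cx.
  rewrite lt0r A_ge0 andbT; apply: contraTneq (a_inv c x p cx p0) => A0.
  have -> : a_up2_mx m (a c x) (fibre K c x) p = 0.
    apply/matrixP => i j; rewrite !mxE /a_up2 FE A0 powR0 ?invr_eq0 ?pnatr_eq0; last by lia.
    by rewrite expr0n subn_eq0 leqNgt m_ge3 invr0 mulr0.
  by apply: unitmx0; exact: leq_trans n_ge4.
have S_upK c x (p : 'rV[R]_n) h i j k (cx : dom c x) (p0 : p != 0) :=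
  S_upE m_ge3 (K_root c x cx).1 (fun q => ((K_root c x cx).2 q).2) h i j k
    (radicand_gt0 c x p cx p0) (a_inv c x p cx p0).
(* The affine relation is S = c1 (lambda + c2); its slope is nonzero since m is at least 3. *)
pose c1 : R := (m%:R - 1) * (m%:R - 2) ^+ 2 / 4; pose c2 : R := (m%:R - 1) ^- 2.
have c1_neq0 : c1 != 0.
  have M1 : m%:R - 1 != 0 :> R by rewrite subr_eq0 gt_eqF // ltr1n ltnW.
  have M2 : m%:R - 2 != 0 :> R by rewrite subr_eq0 gt_eqF // ltr_nat.
  by rewrite !mulf_neq0 ?expf_neq0 // invr_eq0 pnatr_eq0.
split=> [[S S_hom SE]|[lambda l_hom lE]].
(* The relation is solved for lambda; as [c1] and [c2] are constants, degree 0 homogeneity is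
   preserved. *)
- exists (fun z => S z / c1 - c2) => [x p t p0 t0|c x p h i j k cx p0].
    by rewrite (S_hom x p t p0 t0) !expr0 !mul1r.
  have := SE c x p h i j k cx p0; rewrite S_upK // -/c1 -/c2 /fibre => SU.
  by rewrite mulrBl mulrAC -SU; field.
- exists (fun z => c1 * (lambda z + c2)) => [x p t p0 t0|c x p h i j k cx p0].
    by rewrite (l_hom x p t p0 t0) !expr0 !mul1r.
  by rewrite S_upK // lE // -/c1 -/c2 /fibre; ring.
Qed.
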